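(* Let $\mathbf{x}^{\ast}$ be an optimal solution of the convex program (P), let $\boldsymbol{\lambda}^\ast$ be a Lagrange multiplier vector attaining strong duality for (P), and let $D = \beta^{2} + L_{f} + 2 \Vert \boldsymbol{\lambda}^{\ast}\Vert \Vert \mathbf{L}_{\mathbf{g}}\Vert + 2C \Vert \mathbf{L}_{\mathbf{g}}\Vert$. Suppose the step size $\gamma$ of the Algorithm satisfies $$0 < \gamma \leq \frac{1}{(\Vert \mathbf{L}_{\mathbf{g}}\Vert R + \sqrt{D})^{2}}.$$ Then for all $t\geq 1$, $$f(\overline{\mathbf{x}}(t)) \leq f(\mathbf{x}^{\ast}) + \frac{1}{t}\frac{R^{2}}{2\gamma},$$ $$g_{k}(\overline{\mathbf{x}}(t)) \leq \frac{1}{t} \Big(2 \Vert \boldsymbol{\lambda}^\ast \Vert + \frac{R}{\sqrt{\gamma}} + C \Big), \quad \forall k\in\{1,2,\ldots, m\}.$$ In summary, the Algorithm ensures that the error decays like $O(1/t)$ and provides an $\epsilon$-optimal solution with convergence time $O(1/\epsilon)$; that is, there is a constant $K$ (not depending on $t$ or $\epsilon$) such that for every $\epsilon>0$ and every integer $t\ge 1$ with $t \geq K/\epsilon$ one has $f(\overline{\mathbf{x}}(t))\le f(\mathbf{x}^\ast)+\epsilon$ and $g_k(\overline{\mathbf{x}}(t))\le \epsilon$ for all $k\in\{1,\ldots,m\}$.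
   Context: Throughout, $\Vert\cdot\Vert$ is the Euclidean norm and $n,m$ are positive integers. Convex program (P): minimize $f(\mathbf{x})$ subject to $g_k(\mathbf{x})\le 0$ for all $k\in\{1,\ldots,m\}$ and $\mathbf{x}\in\mathcal{X}$, where $\mathcal{X}\subseteq\mathbb{R}^n$ is a compact convex set, and $f,g_1,\ldots,g_m$ are real-valued, convex and continuously differentiable on $\mathcal{X}$. Write $\mathbf{g}(\mathbf{x})=[g_1(\mathbf{x}),\ldots,g_m(\mathbf{x})]^T$. Standing assumptions: (1) There exists a (possibly non-unique) optimal solution $\mathbf{x}^\ast\in\mathcal{X}$ of (P). There is $L_f\ge 0$ with $\Vert\nabla f(\mathbf{x})-\nabla f(\mathbf{y})\Vert\le L_f\Vert\mathbf{x}-\mathbf{y}\Vert$ for all $\mathbf{x},\mathbf{y}\in\mathcal{X}$. For each $k$ there is $L_{g_k}\ge 0$ with $\Vert\nabla g_k(\mathbf{x})-\nabla g_k(\mathbf{y})\Vert\le L_{g_k}\Vert\mathbf{x}-\mathbf{y}\Vert$ for all $\mathbf{x},\mathbf{y}\in\mathcal{X}$; denote $\mathbf{L}_{\mathbf{g}}=[L_{g_1},\ldots,L_{g_m}]^T$. There are constants $\beta$, $C$, $R$ such that for all $\mathbf{x},\mathbf{y}\in\mathcal{X}$: $\Vert\mathbf{g}(\mathbf{x})-\mathbf{g}(\mathbf{y})\Vert\le\beta\Vert\mathbf{x}-\mathbf{y}\Vert$, $\Vert\mathbf{g}(\mathbf{x})\Vert\le C$, and $\Vert\mathbf{x}-\mathbf{y}\Vert\le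 R$. (2) There exists a Lagrange multiplier vector $\boldsymbol{\lambda}^\ast=[\lambda_1^\ast,\ldots,\lambda_m^\ast]\ge\mathbf{0}$ (componentwise) attaining strong duality for (P), i.e. $q(\boldsymbol{\lambda}^\ast)=\min_{\mathbf{x}\in\mathcal{X}}\{f(\mathbf{x}): g_k(\mathbf{x})\le 0,\ \forall k\}$, where $q(\boldsymbol{\lambda})=\min_{\mathbf{x}\in\mathcal{X}}\{f(\mathbf{x})+\sum_{k=1}^m\lambda_k g_k(\mathbf{x})\}$. Algorithm: Let $\gamma>0$ be a constant step size. Choose any $\mathbf{x}(-1)\in\mathcal{X}$ and set $Q_k(0)=\max\{0,-g_k(\mathbf{x}(-1))\}$ for all $k$. For each $t\in\{0,1,2,\ldots\}$: - $\mathbf{d}(t)=\nabla f(\mathbf{x}(t-1))+\sum_{k=1}^m[Q_k(t)+g_k(\mathbf{x}(t-1))]\nabla g_k(\mathbf{x}(t-1))$ and $\mathbf{x}(t)=\mathcal{P}_{\mathcal{X}}[\mathbf{x}(t-1)-\gamma\mathbf{d}(t)]$, where $\mathcal{P}_{\mathcal{X}}$ is the Euclidean projection onto $\mathcal{X}$; - $Q_k(t+1)=\max\{-g_k(\mathbf{x}(t)),\,Q_k(t)+g_k(\mathbf{x}(t))\}$ for all $k\in\{1,\ldots,m\}$; - $\overline{\mathbf{x}}(t+1)=\frac{1}{t+1}\sum_{\tau=0}^{t}\mathbf{x}(\tau)$. Thus $\overline{\mathbf{x}}(t)=\frac1t\sum_{\tau=0}^{t-1}\mathbf{x}(\tau)$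 for $t\ge1$. *)

(* Defs.v *)
From HB Require Import structures.
From mathcomp Require Import all_boot all_order all_algebra.
From mathcomp Require Import all_classical all_reals all_analysis.

Set Implicit Arguments.
Unset Strict Implicit.
Unset Printing Implicit Defensive.

Import Order.TTheory GRing.Theory Num.Theory.
Import numFieldNormedType.Exports.

Local Open Scope classical_set_scope.
Local Open Scope ring_scope.

(* The canonical norm `|u| on 'rV[R]_n is the sup norm, hence the separate
   Euclidean norm; both induce the topology used by compact, nbhs, within. *)
Definition dotv (R : realType) (n : nat) (u v : 'rV[R]_n) : R :=
  \sum_i u ord0 i * v ord0 i.

Definition enorm (R : realType) (n : nat) (u : 'rV[R]_n) : R :=
  Num.sqrt (dotv u u).

(* df is a gradient on X of f, where f only matters on X: Frechet
   differentiability along the filter of neighbourhoods relative to X, so that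
   neither interior points of X nor an extension of f beyond X are needed. It
   holds for the ambient gradient as soon as f is differentiable at the points
   of X (gradient_on_differentiable below). If X has empty interior, df is not
   unique, and any choice is allowed. *)
Definition gradient_on (R : realType) (n : nat) (X : set 'rV[R]_n)
    (f : 'rV[R]_n -> R) (df : 'rV[R]_n -> 'rV[R]_n) : Prop :=
  forall x, X x -> forall y,
    (f y : R^o) = f x + dotv (df x) (y - x)
                  +o_(y \near within X (nbhs x)) (y - x).

Lemma gradient_on_differentiable (R : realType) (n : nat) (X : set 'rV[R]_n)
    (f : 'rV[R]_n -> R^o) :
  (forall x, X x -> differentiable f x) ->
  gradient_on X f (fun x => \row_i 'D_(delta_mx ord0 i) f x).
Proof.
move=> df x Xx.
pose L (y : 'rV[R]_n) : R^o :=
  f x + dotv (\row_i 'D_(delta_mx ord0 i) f x) (y - x).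
have LE y : L y = f x + 'd f x (y - x).
  rewrite [in RHS](row_sum_delta (y - x)) linear_sum /L /dotv; congr (_ + _).
  by apply: eq_bigr => i _; rewrite linearZ /= mxE deriveE 1?mulrC//; exact: df.
suff : f = L +o_ (within X (nbhs x)) (center x) by rewrite funeqE.
apply/eqaddoP => e e0.
have /diff_locallyP[_ /eqaddoP/(_ e e0)] := df x Xx.
rewrite [\forall y \near _, _ <= _](near_shift x) sub0r => dfx.
apply: cvg_within; apply: filterS dfx => y.
rewrite [(f - L) y](_ : _ = f y - L y)// LE.
rewrite [X in `|X| <= _ -> _](_ : _ = f (y - x + x) - (f x + 'd f x (y - x)))//.
by rewrite subrK.
Qed.

Definition C1_on (R : realType) (n : nat) (X : set 'rV[R]_n)
    (f : 'rV[R]_n -> R) (df : 'rV[R]_n -> 'rV[R]_n) : Prop :=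
  gradient_on X f df /\ {within X, continuous df}.

Definition lipschitz_gradient_on (R : realType) (n : nat) (X : set 'rV[R]_n)
    (df : 'rV[R]_n -> 'rV[R]_n) (L : R) : Prop :=
  forall x y, X x -> X y -> enorm (df x - df y) <= L * enorm (x - y).

Definition gvec (R : realType) (n m : nat) (g : 'I_m -> 'rV[R]_n -> R)
    (x : 'rV[R]_n) : 'rV[R]_m :=
  \row_k g k x.

Definition feasible (R : realType) (n m : nat) (X : set 'rV[R]_n)
    (g : 'I_m -> 'rV[R]_n -> R) : set 'rV[R]_n :=
  [set x | X x /\ forall k, g k x <= 0].

Definition is_minimum (R : realType) (A : set R) (v : R) : Prop :=
  A v /\ lbound A v.

Definition optimal_solution (R : realType) (n m : nat) (X : set 'rV[R]_n)
    (f : 'rV[R]_n -> R) (g : 'I_m -> 'rV[R]_n -> R) (xstar : 'rV[R]_n) : Prop :=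
  feasible X g xstar /\ forall x, feasible X g x -> f xstar <= f x.

Definition lagrangian (R : realType) (n m : nat) (f : 'rV[R]_n -> R)
    (g : 'I_m -> 'rV[R]_n -> R) (lam : 'rV[R]_m) (x : 'rV[R]_n) : R :=
  f x + \sum_k lam ord0 k * g k x.

(* The common value v is q(lam), the minimum of the Lagrangian over X, as well
   as the optimal value of the program. *)
Definition attains_strong_duality (R : realType) (n m : nat)
    (X : set 'rV[R]_n) (f : 'rV[R]_n -> R) (g : 'I_m -> 'rV[R]_n -> R)
    (lam : 'rV[R]_m) : Prop :=
  (forall k, 0 <= lam ord0 k) /\
  exists v, is_minimum [set lagrangian f g lam x | x in X] v /\
            is_minimum [set f x | x in feasible X g] v.

Definition is_projection (R : realType) (n : nat) (X : set 'rV[R]_n)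
    (z p : 'rV[R]_n) : Prop :=
  X p /\ forall y, X y -> enorm (z - p) <= enorm (z - y).

Definition direction (R : realType) (n m : nat)
    (g : 'I_m -> 'rV[R]_n -> R)
    (df : 'rV[R]_n -> 'rV[R]_n) (dg : 'I_m -> 'rV[R]_n -> 'rV[R]_n)
    (Q : 'rV[R]_m) (x : 'rV[R]_n) : 'rV[R]_n :=
  df x + \sum_k (Q ord0 k + g k x) *: dg k x.

(* The primal index is shifted by one: x 0 is the initial point x(-1), and
   x t.+1 is the iterate x(t); Q t is Q(t). *)
Definition algorithm_run (R : realType) (n m : nat) (X : set 'rV[R]_n)
    (g : 'I_m -> 'rV[R]_n -> R)
    (df : 'rV[R]_n -> 'rV[R]_n) (dg : 'I_m -> 'rV[R]_n -> 'rV[R]_n)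
    (gamma : R) (x : nat -> 'rV[R]_n) (Q : nat -> 'rV[R]_m) : Prop :=
  [/\ X (x 0%N),
      forall k, Q 0%N ord0 k = Num.max 0 (- g k (x 0%N)),
      forall t, is_projection X
        (x t - gamma *: direction g df dg (Q t) (x t)) (x t.+1) &
      forall t k, Q t.+1 ord0 k =
        Num.max (- g k (x t.+1)) (Q t ord0 k + g k (x t.+1))].

(* (1/t) (x(0) + ... + x(t-1)) in the unshifted indexing; used for t >= 1. *)
Definition running_average (R : realType) (n : nat) (x : nat -> 'rV[R]_n)
    (t : nat) : 'rV[R]_n :=
  t%:R^-1 *: \sum_(tau < t) x tau.+1.

(* Main.v *)
Require Import Defs.
From mathcomp Require Import all_boot all_order all_algebra.
From mathcomp Require Import all_classical all_reals all_analysis.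
From mathcomp Require Import ring lra.

(* The projected gradient step minimizes over X the linearization of
   f + sum_k (Q_k + g_k(x-)) g_k at x- plus a 1/gamma-strongly convex term; the
   max in the queue update keeps the weights Q_k + g_k(x-) nonnegative. For an
   optimal y, the descent lemma and
   2 <g(x-), g(x+)> >= |g(x-)|^2 + |g(x+)|^2 - beta^2 |x+ - x-|^2 then give
     f(x+) + (|Q+|^2 - |Q|^2) / 2 <= f(y) + (|g(x+)|^2 - |g(x-)|^2) / 2
       + (|y - x-|^2 - |y - x+|^2) / (2 gamma)
   as long as gamma (beta^2 + Lf + (|Q| + C) |Lg|) <= 1. This telescopes, and the
   remaining |g(x+)|^2 is absorbed by |Q+|^2 >= |g(x+)|^2. Strong duality bounds
   the sum of the f(x(s)), s < t, below by t f(y) - <lambda, Q(t)>, so the summed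
   inequality bounds |Q(t)|, which keeps the condition on gamma true at the next
   step. Finally sum_(s < t) g_k(x(s)) <= Q_k(t), and Jensen's inequality passes
   to the averages. *)

Set Implicit Arguments.
Unset Strict Implicit.
Unset Printing Implicit Defensive.

Import Order.TTheory GRing.Theory Num.Theory.
Import numFieldNormedType.Exports.

Local Open Scope classical_set_scope.
Local Open Scope ring_scope.

(** * Euclidean inner product and norm *)

Lemma dotvC (R : realType) (n : nat) (u v : 'rV[R]_n) : dotv u v = dotv v u.
Proof. by apply: eq_bigr => i _; rewrite mulrC. Qed.

Lemma dotvDl (R : realType) (n : nat) (u v w : 'rV[R]_n) :
  dotv (u + v) w = dotv u w + dotv v w.
Proof. by rewrite -big_split; apply: eq_bigr => i _; rewrite mxE mulrDl. Qed.

Lemma dotvDr (R : realType) (n : nat) (u v w : 'rV[R]_n) :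
  dotv u (v + w) = dotv u v + dotv u w.
Proof. by rewrite !(dotvC u) dotvDl. Qed.

Lemma dotvZl (R : realType) (n : nat) (a : R) (u v : 'rV[R]_n) :
  dotv (a *: u) v = a * dotv u v.
Proof. by rewrite mulr_sumr; apply: eq_bigr => i _; rewrite mxE mulrA. Qed.

Lemma dotvZr (R : realType) (n : nat) (a : R) (u v : 'rV[R]_n) :
  dotv u (a *: v) = a * dotv u v.
Proof. by rewrite !(dotvC u) dotvZl. Qed.

Lemma dotvNl (R : realType) (n : nat) (u v : 'rV[R]_n) :
  dotv (- u) v = - dotv u v.
Proof. by rewrite -scaleN1r dotvZl mulN1r. Qed.

Lemma dotvNr (R : realType) (n : nat) (u v : 'rV[R]_n) :
  dotv u (- v) = - dotv u v.
Proof. by rewrite !(dotvC u) dotvNl. Qed.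

Definition dotvE := (dotvDl, dotvDr, dotvNl, dotvNr, dotvZl, dotvZr).

Lemma dotv_suml (R : realType) (n m : nat) (F : 'I_m -> 'rV[R]_n)
    (v : 'rV[R]_n) :
  dotv (\sum_k F k) v = \sum_k dotv (F k) v.
Proof.
rewrite /dotv exchange_big; apply: eq_bigr => i _.
by rewrite summxE mulr_suml.
Qed.

Lemma dotvv_ge0 (R : realType) (n : nat) (u : 'rV[R]_n) : 0 <= dotv u u.
Proof. by apply: sumr_ge0 => i _; rewrite -expr2 sqr_ge0. Qed.

Lemma enorm_ge0 (R : realType) (n : nat) (u : 'rV[R]_n) : 0 <= enorm u.
Proof. exact: sqrtr_ge0. Qed.

Lemma sqr_enorm (R : realType) (n : nat) (u : 'rV[R]_n) :
  enorm u ^+ 2 = dotv u u.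
Proof. by rewrite sqr_sqrtr// dotvv_ge0. Qed.

Lemma enorm_coord (R : realType) (n : nat) (u : 'rV[R]_n) (i : 'I_n) :
  u ord0 i <= enorm u.
Proof.
apply: le_trans (ler_norm _) _.
rewrite -(@ler_pXn2r _ 2)// ?nnegrE ?enorm_ge0// sqr_enorm.
rewrite real_normK ?num_real//.
rewrite /dotv (bigD1 i)//= -expr2 lerDl.
by apply: sumr_ge0 => j _; rewrite -expr2 sqr_ge0.
Qed.

(** Cauchy-Schwarz: the squared norm of [dotv v v *: u - dotv u v *: v] is [dotv v v] times the gap
    between the two squared sides. Dividing needs [v] nonzero. *)
Lemma dotv_le_enorm (R : realType) (n : nat) (u v : 'rV[R]_n) :
  dotv u v <= enorm u * enorm v.
Proof.
apply: le_trans (ler_norm _) _.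
rewrite -(@ler_pXn2r _ 2)// ?nnegrE ?mulr_ge0 ?enorm_ge0//.
rewrite real_normK ?num_real// exprMn !sqr_enorm.
have := dotvv_ge0 (dotv v v *: u - dotv u v *: v).
rewrite !dotvE (dotvC v u).
have : 0 <= dotv v v by exact: dotvv_ge0.
rewrite le_eqVlt => /predU1P[v0 _|v0].
  have {}v0 : v = 0.
    apply/rowP => i; apply/eqP; rewrite mxE -sqrf_eq0 eq_le sqr_ge0 andbT.
    rewrite v0 /dotv (bigD1 i)//= -expr2 lerDl.
    by apply: sumr_ge0 => j _; rewrite -expr2 sqr_ge0.
  by rewrite v0 -(scale0r 0) !dotvZr !mul0r mulr0 expr0n.
move=> h; have : 0 <= dotv v v * (dotv u u * dotv v v - dotv u v ^+ 2) by lra.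
by rewrite pmulr_rge0// subr_ge0.
Qed.

Lemma ler_enorm_sqr (R : realType) (n : nat) (u v : 'rV[R]_n) :
  (enorm u <= enorm v) = (dotv u u <= dotv v v).
Proof. by rewrite /enorm ler_sqrt// dotvv_ge0. Qed.

Lemma dotvv_le_sqr (R : realType) (n : nat) (u : 'rV[R]_n) (a : R) :
  enorm u <= a -> dotv u u <= a ^+ 2.
Proof.
move=> ua; rewrite -sqr_enorm lerXn2r// nnegrE; first exact: enorm_ge0.
exact: le_trans (enorm_ge0 u) ua.
Qed.

(** * First-order inequalities for convex functions on X *)

(** Replaces the passage to the limit in a step length or tolerance, which below is always taken to
    be [2^-k]. *)
Lemma le0_geometric (R : realType) (a b : R) :
  (forall k : nat, a <= b / 2 ^+ k) -> a <= 0.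
Proof.
move=> h; rewrite leNgt; apply/negP => a0.
have := h (Num.bound (`|b| / a)); rewrite ler_pdivlMr ?exprn_gt0//.
apply/negP; rewrite -ltNge; apply: le_lt_trans (ler_norm _) _.
rewrite mulrC -ltr_pdivrMr//; apply: lt_trans (archi_boundP _) _.
  by rewrite divr_ge0// ltW.
by rewrite -natrX ltr_nat ltn_expl.
Qed.

Lemma inv2X_itv (R : realType) (k : nat) : 0 < (2 ^+ k : R)^-1 <= 1.
Proof.
by rewrite invr_gt0 exprn_gt0//= invf_le1 ?exprn_gt0// exprn_ege1// ler1n.
Qed.

Lemma convex_set_segment (R : realType) (n : nat) (X : set 'rV[R]_n)
    (x y : 'rV[R]_n) (s : R) :
  convex_set X -> X x -> X y -> 0 <= s <= 1 -> X (x + s *: (y - x)).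
Proof.
move=> cX Xx Xy /andP[s0 s1].
have /set_mem := cX y x (Itv01 s0 s1) (mem_set Xy) (mem_set Xx).
congr X; rewrite /conv/= /unstable.onem scalerBl scale1r scalerBr.
by rewrite addrCA.
Qed.

Lemma convex_function_segment (R : realType) (n : nat) (X : set 'rV[R]_n)
    (f : 'rV[R]_n -> R) (x y : 'rV[R]_n) (s : R) :
  convex_function X f -> X x -> X y -> 0 <= s <= 1 ->
  f (x + s *: (y - x)) <= f x + s * (f y - f x).
Proof.
move=> cf Xx Xy /andP[s0 s1].
have := cf (Itv01 s0 s1) y x (mem_set Xy) (mem_set Xx).
rewrite /conv/= /unstable.onem scalerBl scale1r scalerBr addrCA => h.
by apply: le_trans h _; rewrite /conv/= /unstable.onem /GRing.scale/=; lra.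
Qed.

(** By convexity the difference quotient along the segment is at most [f y - f x]; differentiability
    relative to X, which contains the segment, brings it within [2^-k * |y - x|] of the directional
    term for small [s]. *)
Lemma convex_gradient_le (R : realType) (n : nat) (X : set 'rV[R]_n)
    (f : 'rV[R]_n -> R) (df : 'rV[R]_n -> 'rV[R]_n) (x y : 'rV[R]_n) :
  convex_set X -> convex_function X f -> gradient_on X f df -> X x -> X y ->
  f x + dotv (df x) (y - x) <= f y.
Proof.
move=> cX cf gf Xx Xy; rewrite -subr_le0.
apply: (@le0_geometric _ _ `|y - x|) => k.
pose L (z : 'rV[R]_n) : R^o := f x + dotv (df x) (z - x).
have /eqaddoP : (f : _ -> R^o) = L +o_ (within X (nbhs x)) (center x).
  by apply/funext => z; exact: (gf x Xx z).
have [e0 _] := andP (@inv2X_itv R k).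
move=> /(_ _ e0); rewrite near_withinE => nf.
have cv : (fun s : R => x + s *: (y - x)) @ (0 : R)^'+ --> x.
  rewrite [X in _ --> X](_ : _ = x + (0 : R) *: (y - x)); last first.
    by rewrite scale0r addr0.
  apply: cvgD; first exact: cvg_cst.
  by apply: cvgZr_tmp; apply: cvg_at_right_filter; exact: cvg_id.
have [s [s0 s1 hs]] : exists s : R, [/\ 0 < s, s <= 1 &
    `|(f - L) (x + s *: (y - x))| <=
      (2 ^+ k)^-1 * `|center x (x + s *: (y - x))| ].
  near (0 : R)^'+ => s; exists s.
  have s0 : 0 < s by near: s; exact: nbhs_right_gt.
  have s1 : s <= 1 by near: s; apply: nbhs_right_le.
  split => //.
  have : X (x + s *: (y - x)) by apply: convex_set_segment; rewrite ?ltW.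
  by near: s; exact: (cv _ nf).
have := convex_function_segment cf Xx Xy (_ : 0 <= s <= 1).
rewrite (ltW s0) s1 => /(_ isT) cs.
move: hs; rewrite /= (addrAC x) subrr add0r normrZ (gtr0_norm s0).
rewrite [(f - L) _](_ : _ = f (x + s *: (y - x)) -
    (f x + s * dotv (df x) (y - x))); last first.
  rewrite -[LHS]/(_ - (f x + dotv (df x) (x + s *: (y - x) - x))).
  by rewrite (addrAC x) subrr add0r dotvZr.
rewrite ler_norml => /andP[hs _].
rewrite -(ler_pM2l s0).
by lra.
Unshelve. all: by end_near.
Qed.

(* If the bound holds with c in place of L / 2, applying it on both halves of
   the segment improves c to c / 2 + L / 4, whose fixed point is L / 2. *)
Lemma descent_lemma (R : realType) (n : nat) (X : set 'rV[R]_n)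
    (f : 'rV[R]_n -> R) (df : 'rV[R]_n -> 'rV[R]_n) (L : R) (x y : 'rV[R]_n) :
  convex_set X -> convex_function X f -> gradient_on X f df ->
  lipschitz_gradient_on X df L -> X x -> X y ->
  f y <= f x + dotv (df x) (y - x) + L / 2 * dotv (y - x) (y - x).
Proof.
move=> cX cf gf lf Xx Xy.
have step a z v c : X a -> X z -> 0 <= c -> z - a = c *: v ->
    dotv (df z) v <= dotv (df a) v + L * c * dotv v v.
  move=> Xa Xz c0 zav.
  rewrite -lerBlDl -dotvNl -dotvDl; apply: le_trans (dotv_le_enorm _ _) _.
  apply: le_trans (ler_wpM2r (enorm_ge0 _) (lf z a Xz Xa)) _.
  by rewrite zav /enorm !dotvE mulrA -expr2 sqrtrM ?sqr_ge0// sqrtr_sqr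
    ger0_norm// -!mulrA -expr2 sqr_sqrtr ?dotvv_ge0.
have improve k : forall a b, X a -> X b ->
    f b <= f a + dotv (df a) (b - a) +
      (L / 2 + L / 2 / 2 ^+ k) * dotv (b - a) (b - a).
  (* At [k = 0] the constant is [L]: the gradient inequality at [b] gives the bound with [df b], and
     [step] replaces [df b] by [df a]. *)
  elim: k => [|k IHk] a b Xa Xb.
    have := @step a b (b - a) 1 Xa Xb ler01 (esym (scale1r _)).
    have := convex_gradient_le cX cf gf Xb Xa.
    rewrite -(opprB b a) dotvNr expr0; lra.
  pose h := a + 2^-1 *: (b - a).
  have Xh : X h by apply: convex_set_segment => //; lra.
  have ha : h - a = 2^-1 *: (b - a) by rewrite /h addrC addKr.
  have bh : b - h = 2^-1 *: (b - a).
    rewrite /h opprD addrA -[X in X - _]scale1r -scalerBl.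
    by congr (_ *: _); field.
  have := IHk _ _ Xa Xh; have := IHk _ _ Xh Xb.
  have half_ge0 : 0 <= 2^-1 :> R by rewrite invr_ge0.
  have := step a h (b - a) 2^-1 Xa Xh half_ge0 ha.
  rewrite ha bh !dotvE exprS invfM.
  by clear ha bh; move: (2 ^+ k)^-1 => ?; lra.
rewrite -subr_le0.
apply: (@le0_geometric _ _ (L / 2 * dotv (y - x) (y - x))) => k.
by have := improve k x y Xx Xy; lra.
Qed.

(** * Projected gradient step *)

(** Moving from [p] towards [y] by a fraction [s] cannot decrease the distance to [z]; expanding the
    squares leaves an error [s / 2 * |y - p|^2]. *)
Lemma projection_variational (R : realType) (n : nat) (X : set 'rV[R]_n)
    (z p y : 'rV[R]_n) :
  convex_set X -> is_projection X z p -> X y -> dotv (z - p) (y - p) <= 0.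
Proof.
move=> cX [Xp zp] Xy.
apply: (@le0_geometric _ _ (dotv (y - p) (y - p) / 2)) => k.
have /andP[s0 s1] := inv2X_itv R k; move: s0 s1; set s := _^-1 => s0 s1.
have := zp _ (@convex_set_segment _ _ _ p y s cX Xp Xy _).
rewrite (ltW s0) s1 => /(_ isT); rewrite ler_enorm_sqr opprD addrA.
move: (z - p) (y - p) => u v.
rewrite !dotvE (dotvC v u) => h.
rewrite -(ler_pM2l s0); lra.
Qed.

Lemma projected_step (R : realType) (n : nat) (X : set 'rV[R]_n)
    (x d p y : 'rV[R]_n) (gamma : R) :
  convex_set X -> 0 < gamma -> is_projection X (x - gamma *: d) p -> X y ->
  dotv d (p - x) + dotv (p - x) (p - x) / (2 * gamma) <=
  dotv d (y - x) +
    (dotv (y - x) (y - x) - dotv (y - p) (y - p)) / (2 * gamma).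
Proof.
move=> cX g0 pp Xy; have := projection_variational cX pp Xy.
have -> : x - gamma *: d - p = - (p - x) - gamma *: d.
  by rewrite opprB addrAC.
have -> : y - p = (y - x) - (p - x) by rewrite opprB addrA subrK.
move: (p - x) (y - x) => u v.
rewrite !dotvE (dotvC v u) => h.
rewrite -(ler_pM2l (_ : 0 < 2 * gamma)) ?mulr_gt0//.
have E a b : 2 * gamma * (a + b / (2 * gamma)) = 2 * gamma * a + b.
  by field; rewrite gt_eqF.
by rewrite !E; lra.
Qed.

(** * Running averages and Jensen's inequality *)

Lemma running_averageS (R : realType) (n : nat) (x : nat -> 'rV[R]_n)
    (t : nat) :
  running_average x t.+1 =
  running_average x t + t.+1%:R^-1 *: (x t.+1 - running_average x t).
Proof.
rewrite /running_average big_ord_recr/= scalerBr scalerDr addrCA addrC.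
(* At [t = 0] the average is the zero vector by the convention for [0^-1], and the new point gets
   weight 1. *)
congr (_ + _); case: t => [|t]; first by rewrite big_ord0 !scaler0 subr0.
rewrite scalerA -scalerBl; congr (_ *: _).
have t1 : t.+1%:R != 0 :> R by rewrite pnatr_eq0.
have t2 : t.+1%:R + 1 != 0 :> R by rewrite natr1 pnatr_eq0.
rewrite -[t.+2%:R]natr1; move: t.+1%:R t1 t2 => T t1 t2.
by field; apply/andP.
Qed.

Lemma jensen_running_average (R : realType) (n : nat) (X : set 'rV[R]_n)
    (f : 'rV[R]_n -> R) (x : nat -> 'rV[R]_n) (t : nat) :
  convex_set X -> convex_function X f -> (forall s, X (x s)) -> (1 <= t)%N ->
  f (running_average x t) <= t%:R^-1 * \sum_(s < t) f (x s.+1).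
Proof.
move=> cX cf Xx; case: t => // t _.
(* Membership of the average in X is carried along, since two-point convexity is applied between it
   and the next iterate. *)
suff [] : X (running_average x t.+1) /\
    f (running_average x t.+1) <= t.+1%:R^-1 * \sum_(s < t.+1) f (x s.+1) by [].
elim: t => [|t [IHX IHf]].
  by rewrite /running_average !big_ord1 invr1 scale1r mul1r.
have i01 : 0 <= (t.+2%:R^-1 : R) <= 1.
  by rewrite invr_ge0 ler0n invf_le1 ?ltr0n// ler1n.
rewrite running_averageS; split; first exact: convex_set_segment.
apply: le_trans (convex_function_segment cf IHX (Xx _) i01) _.
rewrite big_ord_recr/=.
move: IHf; move: (f _) (f _) (\sum_(_ < _) _) => a b c.
rewrite -(ler_pM2l (_ : 0 < t.+1%:R))// mulVKf ?pnatr_eq0// => h.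
rewrite -(ler_pM2l (_ : 0 < t.+2%:R))// mulVKf ?pnatr_eq0//.
rewrite mulrDr mulVKf ?pnatr_eq0//.
by move: h; rewrite -(natr1 t.+1); lra.
Qed.

(** * One step of the algorithm *)

Lemma dotv_direction (R : realType) (n m : nat) (g : 'I_m -> 'rV[R]_n -> R)
    (df : 'rV[R]_n -> 'rV[R]_n) (dg : 'I_m -> 'rV[R]_n -> 'rV[R]_n)
    (q : 'rV[R]_m) (x v : 'rV[R]_n) :
  dotv (direction g df dg q x) v =
  dotv (df x) v + \sum_k (q ord0 k + g k x) * dotv (dg k x) v.
Proof.
rewrite dotvDl dotv_suml; congr (_ + _).
by apply: eq_bigr => k _; rewrite dotvZl.
Qed.

(** The descent lemma bounds values at [p] from above, the gradient inequality bounds those at [y]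
    from below, and [projected_step] compares the two linearizations. Nonnegative weights preserve
    both bounds, and feasibility makes the weighted constraints at [y] nonpositive. *)
Lemma primal_step (R : realType) (n m : nat) (X : set 'rV[R]_n)
    (f : 'rV[R]_n -> R) (g : 'I_m -> 'rV[R]_n -> R)
    (df : 'rV[R]_n -> 'rV[R]_n) (dg : 'I_m -> 'rV[R]_n -> 'rV[R]_n)
    (Lf : R) (Lg q : 'rV[R]_m) (gamma : R) (x p y : 'rV[R]_n) :
  convex_set X -> convex_function X f -> (forall k, convex_function X (g k)) ->
  gradient_on X f df -> (forall k, gradient_on X (g k) (dg k)) ->
  lipschitz_gradient_on X df Lf ->
  (forall k, lipschitz_gradient_on X (dg k) (Lg ord0 k)) ->
  0 < gamma -> X x -> feasible X g y ->
  is_projection X (x - gamma *: direction g df dg q x) p ->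
  (forall k, 0 <= q ord0 k + g k x) ->
  f p + \sum_k (q ord0 k + g k x) * g k p <=
  f y + (dotv (y - x) (y - x) - dotv (y - p) (y - p)) / (2 * gamma) +
  (Lf + \sum_k (q ord0 k + g k x) * Lg ord0 k - gamma^-1) / 2 *
    dotv (p - x) (p - x).
Proof.
move=> cX cf cg gf gg lf lg g0 Xx [Xy gy] pp w0.
have Xp : X p by case: pp.
have up := descent_lemma cX cf gf lf Xx Xp.
have low := convex_gradient_le cX cf gf Xx Xy.
have upg : \sum_k (q ord0 k + g k x) * g k p <=
    \sum_k (q ord0 k + g k x) * g k x
    + \sum_k (q ord0 k + g k x) * dotv (dg k x) (p - x)
    + (\sum_k (q ord0 k + g k x) * Lg ord0 k) / 2 * dotv (p - x) (p - x).
  rewrite -mulrA mulr_suml -!big_split/=; apply: ler_sum => k _.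
  have := ler_wpM2l (w0 k) (descent_lemma cX (cg k) (gg k) (lg k) Xx Xp).
  by lra.
have lowg : \sum_k (q ord0 k + g k x) * g k x
    + \sum_k (q ord0 k + g k x) * dotv (dg k x) (y - x) <= 0.
  rewrite -big_split/=; apply: sumr_le0 => k _; rewrite -mulrDr.
  rewrite mulr_ge0_le0//; apply: le_trans (gy k).
  exact: convex_gradient_le cX (cg k) (gg k) Xx Xy.
have := projected_step cX g0 pp Xy; rewrite !dotv_direction.
rewrite invfM; lra.
Qed.

(** Coordinatewise, the right side exceeds the square of [a + b] by [b^2] and the square of [- b] by
    [(a + b)^2]. *)
Lemma queue_drift (R : realType) (m : nat) (q q' h : 'rV[R]_m) :
  (forall k, q' ord0 k = Num.max (- h ord0 k) (q ord0 k + h ord0 k)) ->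
  dotv q' q' <= dotv q q + 2 * dotv q h + 2 * dotv h h.
Proof.
move=> q'E; rewrite /dotv !mulr_sumr -!big_split/=; apply: ler_sum => k _.
rewrite q'E; move: (q _ _) (h _ _) => a b.
by case: (leP (- b) (a + b)) => _; [have := sqr_ge0 b|have := sqr_ge0 (a + b)];
  rewrite expr2; lra.
Qed.

Lemma drift_plus_penalty (R : realType) (n m : nat) (X : set 'rV[R]_n)
    (f : 'rV[R]_n -> R) (g : 'I_m -> 'rV[R]_n -> R)
    (df : 'rV[R]_n -> 'rV[R]_n) (dg : 'I_m -> 'rV[R]_n -> 'rV[R]_n)
    (Lf : R) (Lg q q' : 'rV[R]_m) (beta gamma : R) (x p y : 'rV[R]_n) :
  convex_set X -> convex_function X f -> (forall k, convex_function X (g k)) ->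
  gradient_on X f df -> (forall k, gradient_on X (g k) (dg k)) ->
  lipschitz_gradient_on X df Lf ->
  (forall k, lipschitz_gradient_on X (dg k) (Lg ord0 k)) ->
  enorm (gvec g p - gvec g x) <= beta * enorm (p - x) ->
  0 < gamma -> X x -> feasible X g y ->
  is_projection X (x - gamma *: direction g df dg q x) p ->
  (forall k, 0 <= q ord0 k + g k x) ->
  (forall k, q' ord0 k = Num.max (- g k p) (q ord0 k + g k p)) ->
  (beta ^+ 2 + Lf + (enorm q + enorm (gvec g x)) * enorm Lg) * gamma <= 1 ->
  f p + (dotv q' q' - dotv q q) / 2 <=
  f y + (dotv (gvec g p) (gvec g p) - dotv (gvec g x) (gvec g x)) / 2 +
  (dotv (y - x) (y - x) - dotv (y - p) (y - p)) / (2 * gamma).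
Proof.
move=> cX cf cg gf gg lf lg lip g0 Xx fy pp w0 q'E gam.
have := primal_step cX cf cg gf gg lf lg g0 Xx fy pp w0.
have drift : dotv q' q' <= dotv q q + 2 * dotv q (gvec g p)
    + 2 * dotv (gvec g p) (gvec g p).
  by apply: queue_drift => k; rewrite q'E !mxE.
have -> : \sum_k (q ord0 k + g k x) * g k p =
    dotv q (gvec g p) + dotv (gvec g x) (gvec g p).
  by rewrite -dotvDl; apply: eq_bigr => k _; rewrite !mxE.
have -> : \sum_k (q ord0 k + g k x) * Lg ord0 k =
    dotv q Lg + dotv (gvec g x) Lg.
  by rewrite -dotvDl; apply: eq_bigr => k _; rewrite !mxE.
have lip2 : dotv (gvec g p - gvec g x) (gvec g p - gvec g x) <=
    beta ^+ 2 * dotv (p - x) (p - x).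
  by rewrite -(sqr_enorm (p - x)) -exprMn; exact: dotvv_le_sqr.
have cs1 := dotv_le_enorm q Lg; have cs2 := dotv_le_enorm (gvec g x) Lg.
(* The [beta ^+ 2] pays for [|g(p) - g(x)|^2], left over when the cross term of [primal_step] meets
   the [|g(p)|^2] of the drift. *)
have curv : (beta ^+ 2 + Lf + (dotv q Lg + dotv (gvec g x) Lg) - gamma^-1) *
    dotv (p - x) (p - x) <= 0.
  rewrite mulr_le0_ge0 ?dotvv_ge0// subr_le0 -(ler_pM2r g0) mulVf ?gt_eqF//.
  apply: le_trans gam; rewrite ler_pM2r//.
  by rewrite lerD2l mulrDl lerD.
move: lip2 curv; move: (dotv (p - x) _) => dd.
rewrite !dotvE (dotvC (gvec g p) (gvec g x)); lra.
Qed.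

(** * Scalar estimates for the queue bound and the step size *)

(** Otherwise [q * (q - 2 * a)] would exceed [(b + c)^2], hence [b^2 + c^2]. *)
Lemma quadratic_root_le (R : realType) (q a b c : R) :
  0 <= a -> 0 <= b -> 0 <= c -> q ^+ 2 <= 2 * a * q + b ^+ 2 + c ^+ 2 ->
  q <= 2 * a + b + c.
Proof.
move=> a0 b0 c0 h; rewrite leNgt; apply/negP => h2.
have h3 : (b + c) * (b + c) < q * (q - 2 * a).
  by apply: ltr_pM; lra.
by have := mulr_ge0 b0 c0; move: h h3; rewrite !expr2; lra.
Qed.

(** With [r] and [s] the roots of [gamma] and [d], the hypothesis reads [(a + s) * r <= 1]; then
    [s * r <= 1], so [(s * r)^2 + a * r <= s * r + a * r <= 1]. *)
Lemma step_size_bound (R : realType) (a d gamma : R) :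
  0 <= a -> 0 <= d -> 0 < gamma ->
  (gamma%:E <= (((a + Num.sqrt d) ^+ 2)%R%:E)^-1)%E ->
  (d + a / Num.sqrt gamma) * gamma <= 1.
Proof.
move=> a0 d0 g0 h.
have h1 : (a + Num.sqrt d) ^+ 2 * gamma <= 1.
  (* A vanishing square has inverse [+oo], so [h] says nothing, but the product is then 0. *)
  move: h; rewrite inver; case: eqP => [-> _|/eqP n0].
    by rewrite mul0r.
  rewrite lee_fin => h; rewrite mulrC -ler_pdivlMr ?div1r//.
  by rewrite lt_neqAle eq_sym n0 sqr_ge0.
set r := Num.sqrt gamma; have r0 : 0 < r by rewrite sqrtr_gt0.
have gE : gamma = r ^+ 2 by rewrite sqr_sqrtr// ltW.
have dE : d = Num.sqrt d ^+ 2 by rewrite sqr_sqrtr.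
have s0 := sqrtr_ge0 d; move: h1; rewrite [in X in _ -> X]dE gE.
move: (Num.sqrt d) s0 => s s0; rewrite -exprMn.
have p0 : 0 <= (a + s) * r by rewrite mulr_ge0 ?addr_ge0// ltW.
rewrite expr_le1// => h1.
have -> : (s ^+ 2 + a / r) * r ^+ 2 = (s * r) ^+ 2 + a * r.
  by field; rewrite gt_eqF.
have ar0 : 0 <= a * r by rewrite mulr_ge0// ltW.
have sr0 : 0 <= s * r by rewrite mulr_ge0// ltW.
have : (s * r) ^+ 2 <= s * r by rewrite expr2 ler_piMr//; lra.
lra.
Qed.

(** * Queue bound by induction and convergence rates *)

Theorem theorem3 (R : realType) (n m : nat) (hn : (0 < n)%N) (hm : (0 < m)%N)
    (X : set 'rV[R]_n) (X_compact : compact X) (X_convex : convex_set X)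
    (f : 'rV[R]_n -> R) (g : 'I_m -> 'rV[R]_n -> R)
    (f_convex : convex_function X f)
    (g_convex : forall k, convex_function X (g k))
    (df : 'rV[R]_n -> 'rV[R]_n) (dg : 'I_m -> 'rV[R]_n -> 'rV[R]_n)
    (f_C1 : C1_on X f df) (g_C1 : forall k, C1_on X (g k) (dg k))
    (Lf : R) (Lg : 'rV[R]_m)
    (Lf_ge0 : 0 <= Lf) (Lg_ge0 : forall k, 0 <= Lg ord0 k)
    (f_smooth : lipschitz_gradient_on X df Lf)
    (g_smooth : forall k, lipschitz_gradient_on X (dg k) (Lg ord0 k))
    (beta C Rad : R)
    (g_lip : forall x y, X x -> X y ->
      enorm (gvec g x - gvec g y) <= beta * enorm (x - y))
    (g_bounded : forall x, X x -> enorm (gvec g x) <= C)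
    (X_diam : forall x y, X x -> X y -> enorm (x - y) <= Rad)
    (xstar : 'rV[R]_n) (xstar_opt : optimal_solution X f g xstar)
    (lam : 'rV[R]_m) (lam_dual : attains_strong_duality X f g lam)
    (D : R)
    (D_def : D = beta ^+ 2 + Lf + 2 * enorm lam * enorm Lg + 2 * C * enorm Lg)
    (gamma : R) (gamma_gt0 : 0 < gamma)
    (* inverse in \bar R, where 0^-1 = +oo: no upper bound on gamma if the
       denominator vanishes *)
    (gamma_le : (gamma%:E <=
      (((enorm Lg * Rad + Num.sqrt D) ^+ 2)%R%:E)^-1)%E)
    (x : nat -> 'rV[R]_n) (Q : nat -> 'rV[R]_m)
    (run : algorithm_run X g df dg gamma x Q) :
  (forall t : nat, (1 <= t)%N ->
     f (running_average x t) <= f xstar + t%:R^-1 * (Rad ^+ 2 / (2 * gamma)) /\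
     forall k : 'I_m,
       g k (running_average x t) <=
         t%:R^-1 * (2 * enorm lam + Rad / Num.sqrt gamma + C)) /\
  (exists K : R, forall (eps : R) (t : nat),
     0 < eps -> (1 <= t)%N -> K / eps <= t%:R ->
     f (running_average x t) <= f xstar + eps /\
     forall k : 'I_m, g k (running_average x t) <= eps).

Proof.
case: run => Xx0 Q0E proj QE.
have Xx t : X (x t) by case: t => // t; case: (proj t).
have [[Xs _] _] := xstar_opt.
have C0 : 0 <= C := le_trans (enorm_ge0 _) (g_bounded _ Xs).
have Rad0 : 0 <= Rad := le_trans (enorm_ge0 _) (X_diam _ _ Xs Xs).
have [gf _] := f_C1; have gg k : gradient_on X (g k) (dg k) by case: (g_C1 k).
have [lam0 [v [[_ vL] [[s Fs fs] _]]]] := lam_dual.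
have weak y : X y -> f xstar <= f y + \sum_k lam ord0 k * g k y.
  move=> Xy; have [_ fle] := xstar_opt.
  have /le_trans : f xstar <= v by rewrite -fs; exact: fle.
  by apply; apply: vL; exists y.
have Q_ge0 t k : 0 <= Q t ord0 k.
  elim: t => [|t IHt]; first by rewrite Q0E le_max lexx.
  rewrite QE le_max.
  by case: (leP 0 (g k (x t.+1))) => h; apply/orP; [right|left]; lra.
have Qg t k : 0 <= Q t ord0 k + g k (x t).
  case: t => [|t]; first by rewrite Q0E -lerBlDr sub0r le_max lexx orbT.
  by rewrite QE -lerBlDr sub0r le_max lexx.
(* Starts the induction: the initial queue is paid for by the term in [g (x 0)] left by
   telescoping. *)
have normQ0 : dotv (Q 0) (Q 0) <= dotv (gvec g (x 0)) (gvec g (x 0)).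
  apply: ler_sum => k _; rewrite Q0E !mxE /Num.max; case: ifP => _.
    by rewrite mulrNN.
  by rewrite mul0r -expr2 sqr_ge0.
(* Both [- g k] and, as the old queue is nonnegative, [g k] lie below the new queue. *)
have normQ t :
    dotv (gvec g (x t.+1)) (gvec g (x t.+1)) <= dotv (Q t.+1) (Q t.+1).
  apply: ler_sum => k _; rewrite !mxE -!expr2 -real_normK ?num_real//.
  rewrite ler_pXn2r// ?nnegrE// QE ler_norml lerNl !le_max lexx lerDr Q_ge0.
  by rewrite orbT.
have sumg t k : \sum_(s < t) g k (x s.+1) <= Q t ord0 k.
  elim: t => [|t IHt]; first by rewrite big_ord0.
  by rewrite big_ord_recr/= QE le_max lerD2r IHt orbT.
have sum_weak t : t%:R * f xstar <= \sum_(s < t) f (x s.+1) + dotv lam (Q t).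
  apply: (@le_trans _ _ (\sum_(s < t)
      (f (x s.+1) + \sum_k lam ord0 k * g k (x s.+1)))).
    rewrite mulr_natl -[X in _ *+ X]card_ord -sumr_const.
    by apply: ler_sum => i _; exact: weak.
  rewrite big_split/= lerD2l exchange_big; apply: ler_sum => k _.
  by rewrite -mulr_sumr ler_wpM2l ?sumg.
set B := 2 * enorm lam + Rad / Num.sqrt gamma + C.
(* The one-step inequality with [y = xstar], summed over [t] steps. *)
pose inv t := \sum_(s < t) f (x s.+1) + dotv (Q t) (Q t) / 2 +
    dotv (xstar - x t) (xstar - x t) / (2 * gamma) <=
  t%:R * f xstar + dotv (gvec g (x t)) (gvec g (x t)) / 2 +
    Rad ^+ 2 / (2 * gamma).
have dist_ge0 t : 0 <= dotv (xstar - x t) (xstar - x t) / (2 * gamma).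
  by rewrite divr_ge0 ?dotvv_ge0// mulr_ge0// ltW.
(* Inserting [sum_weak] into [inv t] gives [|Q|^2 <= 2 |lam| |Q| + Rad^2 / gamma + C^2]. *)
have Qbound t : inv t -> enorm (Q t) <= B.
  rewrite /inv => h; apply: quadratic_root_le;
    rewrite ?enorm_ge0 ?divr_ge0 ?sqrtr_ge0//.
  rewrite sqr_enorm exprMn exprVn (sqr_sqrtr (ltW gamma_gt0)).
  have := sum_weak t; have := dotv_le_enorm lam (Q t).
  have := dist_ge0 t; have := dotvv_le_sqr (g_bounded _ (Xx t)).
  move: h; rewrite invfM; lra.
(* By the choice of [B], the bracket equals [D + enorm Lg * Rad / Num.sqrt gamma]. *)
have gam : (beta ^+ 2 + Lf + (B + C) * enorm Lg) * gamma <= 1.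
  have D0 : 0 <= D.
    by rewrite D_def !addr_ge0 ?sqr_ge0// !mulr_ge0// enorm_ge0.
  have := step_size_bound _ D0 gamma_gt0 gamma_le.
  rewrite mulr_ge0 ?enorm_ge0// => /(_ isT); rewrite D_def /B.
  congr (_ * gamma <= 1); ring.
have invP t : inv t.
  elim: t => [|t IHt]; rewrite /inv.
    rewrite big_ord0 mul0r !add0r lerD ?ler_pM2r ?invr_gt0 ?mulr_gt0//.
    by apply: dotvv_le_sqr; exact: X_diam.
  (* Its step-size condition at [t] follows from [gam], because [inv t] already bounds [Q t] by
     [B]. *)
  have := @drift_plus_penalty _ _ _ X f g df dg Lf Lg (Q t) (Q t.+1) beta gamma
    (x t) (x t.+1) xstar X_convex f_convex g_convex gf gg f_smooth g_smooth
    (g_lip _ _ (Xx _) (Xx _)) gamma_gt0 (Xx t) (proj1 xstar_opt) (proj t) (Qg t)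
    (QE t).
  have -> : (beta ^+ 2 + Lf + (enorm (Q t) + enorm (gvec g (x t))) *
      enorm Lg) * gamma <= 1.
    apply: le_trans gam; rewrite ler_pM2r// lerD2l ler_wpM2r ?enorm_ge0//.
    by rewrite lerD ?Qbound// g_bounded.
  move=> /(_ isT); move: IHt; rewrite /inv big_ord_recr/= -natr1 invfM; lra.
have fbound t : (1 <= t)%N ->
    f (running_average x t) <= f xstar + t%:R^-1 * (Rad ^+ 2 / (2 * gamma)).
  (* From [t = 1] on, [normQ] cancels the remaining constraint term against the queue term. *)
  case: t => // t t1.
  apply: le_trans (jensen_running_average X_convex f_convex Xx t1) _.
  have t0 : 0 < t.+1%:R :> R by [].
  rewrite -(ler_pM2l t0) mulrDr !mulVKf ?gt_eqF//.
  have := invP t.+1; have := dist_ge0 t.+1; have := normQ t; rewrite /inv; lra.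
have gbound t k : (1 <= t)%N -> g k (running_average x t) <= t%:R^-1 * B.
  move=> t1.
  apply: le_trans (jensen_running_average X_convex (g_convex k) Xx t1) _.
  rewrite ler_wpM2l ?invr_ge0 ?ler0n//; apply: le_trans (sumg t k) _.
  exact: le_trans (enorm_coord _ _) (Qbound t (invP t)).
split=> [t t1|]; first by split=> [|k]; [exact: fbound|exact: gbound].
exists (Num.max (Rad ^+ 2 / (2 * gamma)) B) => eps t eps0 t1.
have t0 : 0 < t%:R :> R by rewrite ltr0n.
rewrite ler_pdivrMr// ge_max => /andP[hf hg]; split=> [|k].
  by apply: le_trans (fbound t t1) _; rewrite lerD2l ler_pdivrMl.
by apply: le_trans (gbound t k t1) _; rewrite ler_pdivrMl.
Qed.
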